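(* For every integer $n \ge 0$, $$ \iint_{T} \frac{(-\ln (xy))^n}{xy}\,dx\,dy \;=\; n! \sum_{k=0}^n \zeta\big(n-k+2,\underbrace{1,\dots,1}_{k}\big), $$ where $T$ is the (closed) triangle in $\mathbb{R}^2$ with vertices $(1,0)$, $(0,1)$, $(1,1)$, i.e. $T=\{(x,y): 0\le x\le 1,\ 0\le y\le 1,\ x+y\ge 1\}$.
   Context: For integers $s_1\ge 2$ and $s_2,\dots,s_l\ge 1$, the multiple zeta value is $$ \zeta(s_1,\dots,s_l)=\sum_{n_1>n_2>\cdots>n_l\ge 1}\frac{1}{n_1^{s_1}\cdots n_l^{s_l}}. $$ In the sum, the $k=0$ term is the Riemann zeta value $\zeta(n+2)$. *)

(* Defs.v *)
From HB Require Import structures.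
From mathcomp Require Import all_boot all_order all_algebra.
From mathcomp Require Import all_classical all_reals all_analysis.
Set Implicit Arguments. Unset Strict Implicit. Unset Printing Implicit Defensive.
Import Order.TTheory GRing.Theory Num.Theory.
Import numFieldNormedType.Exports.
Local Open Scope ring_scope.
Local Open Scope classical_set_scope.

Fixpoint mzv_trunc {R : realType} (s : seq nat) (N : nat) : R :=
  match s with
  | [::] => 1
  | s1 :: ss => \sum_(1 <= m < N) ((m%:R) ^+ s1)^-1 * mzv_trunc ss m
  end.

(* Multiple zeta value zeta(s1,...,sl): limit of the truncated sums
   (the series has nonnegative terms and converges for s1 >= 2). *)
Definition mzv {R : realType} (s : seq nat) : R :=
  limn (fun N : nat => mzv_trunc (R:=R) s N).

Definition triangleT {R : realType} : set (R * R) :=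
  [set p | (0 <= p.1 <= 1) /\ (0 <= p.2 <= 1) /\ 1 <= p.1 + p.2].

(* Main.v *)
(** For [0 < x < 1] the slice of the triangle is [1 - x <= y <= 1], and
    integrating in [y] gives
    [((A + B)^(n+1) - A^(n+1)) / ((n+1) x)] with [A = - ln x] and
    [B = - ln (1 - x)], that is,
    [n! \sum_(k <= n) A^(n-k)/(n-k)! * B^(k+1)/(k+1)! / x] by the binomial theorem.
    Write [H_k m] for the [k]-th elementary symmetric function of
    [1, 1/2, ..., 1/(m-1)].  By induction on [k],
    [B^(k+1)/(k+1)! = \sum_m (H_k m / m) x^m]: dividing a power series by [1 - x]
    replaces its coefficients by their partial sums, and integration then divides
    by the exponent.  Finally
    [\int_0^1 x^(m-1) A^p dx = p! / m^(p+1)], so the [k]-th summand contributes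
    [\sum_m H_k m / m^(n-k+2)], which is the multiple zeta value. *)
Require Import Defs.
From HB Require Import structures.
From mathcomp Require Import all_boot all_order all_algebra.
From mathcomp Require Import all_classical all_reals all_analysis.
From mathcomp Require Import measurable_realfun ring lra.
Import Order.TTheory GRing.Theory Num.Theory.
Import numFieldNormedType.Exports.
Local Open Scope ring_scope.
Local Open Scope classical_set_scope.

(** * Boundedness and convergence of the truncated sums *)

(* At [N = 0] this relies on [0^-1 = 0]; it lets the series below start at 0. *)
Lemma mzv_truncS (R : realType) (s : nat) (ss : seq nat) (N : nat) : (0 < s)%N ->
  mzv_trunc (s :: ss) N.+1 =
  mzv_trunc (s :: ss) N + (N%:R ^+ s)^-1 * mzv_trunc ss N :> R.
Proof.
move=> s0 /=; case: N => [|N]; last by rewrite big_nat_recr.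
by rewrite !big_geq // expr0n eqn0Ngt s0 invr0 mul0r addr0.
Qed.

Lemma mzv_trunc_series (R : realType) (s : nat) (ss : seq nat) : (0 < s)%N ->
  mzv_trunc (s :: ss) =
  series (fun m => (m%:R ^+ s)^-1 * mzv_trunc ss m) :> (nat -> R).
Proof.
move=> s0; apply/funext; elim=> [|N IH]; first by rewrite /= big_geq// /series /= big_geq.
by rewrite mzv_truncS// IH /series /= big_nat_recr.
Qed.

Lemma mzv_trunc_ge0 (R : realType) (s : seq nat) (N : nat) :
  0 <= mzv_trunc s N :> R.
Proof.
elim: s N => [|s1 ss IH] N //=.
by apply: sumr_ge0 => m _; rewrite mulr_ge0// invr_ge0 exprn_ge0.
Qed.

(** Termwise comparison reduces boundedness for any leading exponent at least 2 to the exponent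
    2. *)
Lemma mzv_trunc_le (R : realType) (s : nat) (ss : seq nat) (N : nat) :
  (2 <= s)%N -> mzv_trunc (s :: ss) N <= mzv_trunc (2 :: ss) N :> R.
Proof.
move=> s2 /=; apply: ler_sum_nat => m /andP[m1 _].
rewrite ler_wpM2r ?mzv_trunc_ge0// lef_pV2 ?posrE ?exprn_gt0 ?ltr0n//.
by rewrite ler_weXn2l// ler1n.
Qed.

(** One step of the tail bound for the sum of [m^-2]; the two sides differ by exactly
    [1 / ((N+1) (N+2)^2)]. *)
Lemma invf_sqr_telescope_le (R : realType) (N : nat) :
  (N.+2%:R ^+ 2)^-1 + N.+2%:R^-1 <= N.+1%:R^-1 :> R.
Proof.
rewrite -subr_ge0.
have -> : (N.+1%:R^-1 - ((N.+2%:R ^+ 2)^-1 + N.+2%:R^-1) : R)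
    = (N.+1%:R * N.+2%:R ^+ 2)^-1.
  have : (N.+1%:R : R) != 0 by rewrite pnatr_eq0.
  have : (N.+2%:R : R) != 0 by rewrite pnatr_eq0.
  rewrite -(natr1 N.+1); move: (N.+1%:R) => x h1 h2; field.
  by rewrite h1 h2.
by rewrite invr_ge0 mulr_ge0// exprn_ge0.
Qed.

(* The added term majorizes the tail [H_{k+1} \sum_(m > N + 1) m^-2], which makes
   the left-hand side comparable with the sum of depth one less. *)
Lemma mzv_trunc2_step (R : realType) (k N : nat) :
  mzv_trunc [:: 2, 1 & nseq k 1]%N N.+2 + N.+1%:R^-1 * mzv_trunc (1%N :: nseq k 1%N) N.+2
  <= mzv_trunc (2%N :: nseq k 1%N) N.+2 :> R.
Proof.
elim: N => [|N IH].
  rewrite [mzv_trunc [:: _, _ & _] _]/= [mzv_trunc (1%N :: _) _]/= [X in _ <= X]/=.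
  rewrite !big_nat1 !expr1n !invr1 !mul1r.
  rewrite [X in X + _](_ : _ = 0) ?add0r//.
  by rewrite big_geq.
rewrite (@mzv_truncS R 2 (1%N :: _))// (@mzv_truncS R 2 (nseq k _))//.
rewrite (@mzv_truncS R 1 _ N.+2)// expr1.
(* Both sides have gained [d / (N+2)^2]; beyond [IH], only the coefficients of [b] remain to be
   compared, which is [invf_sqr_telescope_le]. *)
move: IH; set a := mzv_trunc [:: _, _ & _] _; set b := mzv_trunc (1%N :: _) _.
set c := mzv_trunc (2%N :: _) _; set d := mzv_trunc _ _ => IH.
have b0 : 0 <= b by exact: mzv_trunc_ge0.
have /(ler_wpM2r b0) := @invf_sqr_telescope_le R N.
rewrite mulrDl -!exprVn => h.
move: h IH; move: (N.+2%:R^-1) (N.+1%:R^-1) => x y h IH; lra.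
Qed.

(** By [mzv_trunc2_step] each depth is bounded by the previous one, so all depths inherit the bound
    for the partial sums of zeta(2). *)
Lemma mzv_trunc2_bounded (R : realType) (k N : nat) :
  mzv_trunc (2%N :: nseq k 1%N) N <= 2 :> R.
Proof.
have Nle (l M : nat) : mzv_trunc (2%N :: nseq l 1%N) M <= mzv_trunc (2%N :: nseq l 1%N) M.+2 :> R.
  rewrite 2?mzv_truncS// -addrA lerDl addr_ge0// mulr_ge0 ?mzv_trunc_ge0//;
    by rewrite invr_ge0 exprn_ge0.
apply: (le_trans (Nle k N)).
elim: k => [|k IH]; last first.
  apply: le_trans IH; apply: le_trans (mzv_trunc2_step R k N).
  by rewrite lerDl mulr_ge0 ?mzv_trunc_ge0.
(* The extra [1/(N+1)] makes the induction close: the strengthened left side is nonincreasing in [N]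
   and equals 2 at [N = 0]. *)
suff : mzv_trunc [:: 2%N] N.+2 + N.+1%:R^-1 <= 2 :> R.
  by apply: le_trans; rewrite lerDl.
elim: N => [|N IH].
  by rewrite /= big_nat1 expr1n invr1 mulr1; lra.
rewrite mzv_truncS// mulr1.
apply: le_trans IH; rewrite -addrA lerD2l.
exact: invf_sqr_telescope_le.
Qed.

Lemma mzv_trunc_is_cvg (R : realType) (s k : nat) : (2 <= s)%N ->
  cvgn (mzv_trunc (s :: nseq k 1%N) : nat -> R).
Proof.
move=> s2; apply: nondecreasing_is_cvgn.
  rewrite mzv_trunc_series ?(leq_trans _ s2)//.
  apply: nondecreasing_series => m _ _.
  by rewrite mulr_ge0 ?mzv_trunc_ge0// invr_ge0 exprn_ge0.
exists 2 => _ [N _ <-].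
exact: le_trans (mzv_trunc_le _ _ _ _ s2) (mzv_trunc2_bounded _ _ _).
Qed.

(** This is the form in which termwise integration delivers the value. *)
Lemma mzv_eseries (R : realType) (s k : nat) : (2 <= s)%N ->
  (\sum_(m <oo) (((m%:R ^+ s)^-1 * mzv_trunc (nseq k 1%N) m)%:E) =
   (mzv (s :: nseq k 1%N) : R)%:E)%E.
Proof.
move=> s2; rewrite /mzv -EFin_lim; last exact: mzv_trunc_is_cvg.
congr (limn _); apply/funext => N /=.
rewrite sumEFin; congr (_%:E).
by have /(congr1 (@^~ N)) := @mzv_trunc_series R s (nseq k 1%N) (ltnW s2).
Qed.

(** * Tools from calculus and power series *)

(** Two-sided derivatives at the endpoints as well give the one-sided continuity of [F] there;
    derivability of [f] gives its continuity. *)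
Lemma is_derive_FTC2 (R : realType) (f F : R -> R) (a b : R) : a < b ->
  (forall x, a <= x <= b -> is_derive x 1 F (f x)) ->
  (forall x, a <= x <= b -> derivable f x 1) ->
  (\int[@lebesgue_measure R]_(x in `[a, b]) (f x)%:E = (F b - F a)%:E)%E.
Proof.
move=> ab dF df.
have F1 x : a <= x <= b -> derivable F x 1.
  by move=> /dF h; exact: ex_derive.
have Fc x : a <= x <= b -> F y @[y --> x] --> F x.
  by move=> /F1 /derivable1_diffP /differentiable_continuous.
rewrite (@continuous_FTC2 _ _ F) ?EFinB//.
- by apply: derivable_within_continuous => x; rewrite in_itv/=; exact: df.
- split.
  + by move=> x; rewrite in_itv/= => /andP[ax xb]; apply: F1; rewrite !ltW.
  + by apply: cvg_at_right_filter; apply: Fc; rewrite lexx ltW.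
  + by apply: cvg_at_left_filter; apply: Fc; rewrite lexx ltW.
- move=> x; rewrite in_itv/= => /andP[ax xb].
  have h : is_derive x 1 F (f x) by apply: dF; rewrite !ltW.
  by rewrite derive1E derive_val.
Qed.

(** Summation by parts expresses [(1 - t)] times the new partial sum as the old partial sum minus a
    boundary term. Nonnegativity then bounds the new partial sums, hence they converge, and this in
    turn kills the boundary term. *)
Lemma series_div_1B (R : realType) (a : nat -> R) (t l : R) :
  (forall m, 0 <= a m) -> 0 <= t < 1 ->
  series (fun m => a m * t ^+ m) @ \oo --> l ->
  series (fun m => series a m.+1 * t ^+ m) @ \oo --> l / (1 - t).
Proof.
move=> a0 /andP[t0 t1] al.
have t1' : 0 < 1 - t by rewrite subr_gt0.
have E0 m : 0 <= series a m by rewrite /series/=; apply: sumr_ge0.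
pose S := series (fun m => series a m.+1 * t ^+ m).
have id M : (1 - t) * S M = series (fun m => a m * t ^+ m) M - series a M * t ^+ M.
  rewrite /S; elim: M => [|M IH].
    by rewrite /series /= !big_geq// !mul0r mulr0 subr0.
  have E1 : series a M.+1 = series a M + a M by rewrite /series/= big_nat_recr.
  have -> : series (fun m => series a m.+1 * t ^+ m) M.+1 =
    series (fun m => series a m.+1 * t ^+ m) M + series a M.+1 * t ^+ M.
    by rewrite {1}/series/= big_nat_recr.
  have -> : series (fun m => a m * t ^+ m) M.+1 = series (fun m => a m * t ^+ m) M + a M * t ^+ M.
    by rewrite {1}/series/= big_nat_recr.
  by rewrite mulrDr IH E1 exprS; ring.
have al' M : series (fun m => a m * t ^+ m) M <= l.
  rewrite -(cvg_lim _ al)//; apply: nondecreasing_cvgn_le.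
    by apply: nondecreasing_series => m _ _; rewrite mulr_ge0// exprn_ge0.
  by apply/cvg_ex; exists l.
have cS : cvgn S.
  apply: nondecreasing_is_cvgn.
    by apply: nondecreasing_series => m _ _; rewrite mulr_ge0// exprn_ge0.
  exists (l / (1 - t)) => _ [M _ <-].
  rewrite ler_pdivlMr// mulrC id lerBlDr.
  by rewrite (le_trans (al' M))// lerDl mulr_ge0// exprn_ge0.
(* After an index shift the boundary term is [t] times the general term of the convergent series
   [S]. *)
have E00 : series a M * t ^+ M @[M --> \oo] --> 0.
  have : series a M.+1 * t ^+ M @[M --> \oo] --> 0 by exact: cvg_series_cvg_0.
  move=> /(@cvgMl_tmp _ _ _ _ _ t); rewrite mulr0.
  rewrite -(cvg_shiftS (fun M => series a M * t ^+ M)) /=.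
  have -> // : (fun M => t * (series a M.+1 * t ^+ M)) =
    (fun M => series a M.+1 * t ^+ M.+1).
  by apply/funext => M; rewrite exprS; ring.
have -> : series (fun m => series a m.+1 * t ^+ m) =
  (fun M => (series (fun m => a m * t ^+ m) M - series a M * t ^+ M) / (1 - t)).
  by apply/funext => M; rewrite -id mulrAC mulfV ?mul1r// gt_eqF.
apply: cvgMr_tmp; rewrite -[X in _ --> X]subr0; exact: cvgB.
Qed.

Lemma is_derive_exprn (R : realType) (f : R -> R) (x df : R) (n : nat) :
  is_derive x 1 f df -> is_derive x 1 (fun y => f y ^+ n) (n%:R * f x ^+ n.-1 * df).
Proof.
move=> h; have -> : (fun y => f y ^+ n) = f ^+ n.
  by apply/funext => y; rewrite exprfctE.
exact: is_deriveX.
Qed.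

Lemma is_deriveMr (R : realType) (f : R -> R) (x df c : R) :
  is_derive x 1 f df -> is_derive x 1 (fun y => f y * c) (df * c).
Proof.
move=> h; have := is_deriveM h (is_derive_cst c x 1).
by move=> h'; apply: is_derive_eq; rewrite scaler0 add0r mulrC.
Qed.

Lemma is_derive_Nln (R : realType) (x : R) : 0 < x ->
  is_derive x 1 (fun y => - ln y) (- x^-1).
Proof.
by move=> x0; have h := is_derive1_ln x0; exact: is_deriveN.
Qed.

Lemma is_derive_Nln1B (R : realType) (x : R) : x < 1 ->
  is_derive x 1 (fun y => - ln (1 - y)) (1 - x)^-1.
Proof.
move=> x1; have x1' : 0 < 1 - x by rewrite subr_gt0.
have h1 : is_derive x 1 (fun y : R => 1 - y) (0 - 1) by exact: is_deriveB.
have := @is_derive1_comp _ (fun y => - ln y) (fun y => 1 - y) _ _ _ (is_derive_Nln _ _ x1') h1.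
by move=> h; apply: is_derive_eq; rewrite sub0r mulrN1 opprK.
Qed.

Lemma nneseries_EFin_eq (R : realType) (u : nat -> R) (l : R) :
  (forall m, 0 <= u m) ->
  (\sum_(m <oo) (u m)%:E = l%:E)%E <-> series u @ \oo --> l.
Proof.
move=> u0.
have E : (fun N => \sum_(0 <= m < N) (u m)%:E)%E = EFin \o series u.
  by apply/funext => N /=; rewrite sumEFin.
split=> [h|h].
  have : (EFin \o series u) N @[N --> \oo] --> l%:E.
    by rewrite -h -E; apply: is_cvg_nneseries => m _ _; rewrite lee_fin.
  by move/fine_cvgP => [_].
rewrite E EFin_lim; last by apply/cvg_ex; exists l.
by congr (_%:E); exact: cvg_lim.
Qed.

Lemma integral_exprn (R : realType) (x : R) (m : nat) : 0 < x ->
  (\int[@lebesgue_measure R]_(t in `[0%R, x]) (t ^+ m)%:E =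
   (x ^+ m.+1 / m.+1%:R)%:E)%E.
Proof.
move=> x0.
have dF t : 0 <= t <= x ->
    is_derive t 1 (fun y => y ^+ m.+1 / m.+1%:R : R) (t ^+ m).
  move=> _.
  have := is_deriveMr _ _ _ _ (m.+1%:R^-1) (is_derive_exprn _ _ _ _ m.+1 (is_derive_id t 1)).
  move=> h; apply: is_derive_eq => /=.
  by rewrite mulr1 mulrAC mulfV ?mul1r// pnatr_eq0.
have -> := is_derive_FTC2 _ (fun t => t ^+ m) _ _ _ x0 dF.
  by rewrite expr0n /= mul0r subr0.
by move=> t _; exact: exprn_derivable.
Qed.

(** * Power series of the powers of -ln(1 - x) *)

(** One induction step for the expansion: [f t / (1 - t)] has coefficient [series a m] at [t^(m-1)],
    and integrating over [[0, x]] term by term, legitimate by nonnegativity, turns it into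
    [series a m / m] at [x^m]. *)
Lemma series_integral_div_1B (R : realType) (a : nat -> R) (f F : R -> R) (x : R) :
  (forall m, 0 <= a m) -> 0 <= x < 1 ->
  (forall t : R, 0 <= t < 1 -> series (fun m => a m * t ^+ m) @ \oo --> f t) ->
  (forall t : R, 0 <= t < 1 -> derivable f t 1) ->
  (forall t : R, 0 <= t < 1 -> is_derive t 1 F (f t / (1 - t))) ->
  F 0 = 0 ->
  series (fun m => series a m / m%:R * x ^+ m) @ \oo --> F x.
Proof.
move=> a0 /andP[x0 x1] af df dF F0.
have c0 m : 0 <= series a m by rewrite /series/=; apply: sumr_ge0.
pose g m := series a m.+1 * (x ^+ m.+1 / m.+1%:R).
(* The term at [m = 0] vanishes since [0^-1 = 0], so the index can be shifted. *)
rewrite -(cvg_shiftS (series _)) /=.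
have -> : (fun N => series (fun m => series a m / m%:R * x ^+ m) N.+1) = series g.
  apply/funext => N; rewrite /series /= big_nat_recl// mulr0n invr0 mulr0 mul0r add0r.
  by apply: eq_bigr => i _; rewrite /g mulrAC mulrA.
have [x00|xn0] := eqVneq x 0.
  rewrite x00 F0; have -> : series g = cst 0.
    apply/funext => N; rewrite /series /= big1// => i _.
    by rewrite /g x00 expr0n /= mul0r mulr0.
  exact: cvg_cst.
have {}x0 : 0 < x by rewrite lt_neqAle eq_sym xn0.
have inI (t : R) : 0 <= t <= x -> 0 <= t < 1.
  by move=> /andP[-> /le_lt_trans]; apply.
apply/nneseries_EFin_eq.
  by move=> m; rewrite mulr_ge0// divr_ge0// exprn_ge0// ltW.
have <- : (\int[@lebesgue_measure R]_(t in `[0%R, x]) (f t / (1 - t))%:E = (F x)%:E)%E.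
  have -> := is_derive_FTC2 _ (fun t => f t / (1 - t)) F _ _ x0 (fun t tx => dF t (inI t tx)).
    by rewrite F0 subr0.
  move=> t /inI t01; apply: derivableM; first exact: df.
  apply: derivableV.
    by rewrite subr_eq0 gt_eqF//; case/andP: t01.
  exact: derivableB.
have -> : (\int[@lebesgue_measure R]_(t in `[0%R, x]) (f t / (1 - t))%:E =
    \int[@lebesgue_measure R]_(t in `[0%R, x])
      (\sum_(m <oo) (series a m.+1 * t ^+ m)%:E))%E.
  apply: eq_integral => t; rewrite inE /= in_itv/= => /inI t01.
  apply/esym/nneseries_EFin_eq.
    by move=> m; rewrite mulr_ge0// exprn_ge0//; case/andP: t01.
  by apply: series_div_1B => //; exact: af.
rewrite integral_nneseries//=.
- apply: eq_eseriesr => m _.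
  under eq_integral do rewrite EFinM.
  rewrite ge0_integralZl_EFin//=.
  + by rewrite integral_exprn// -EFinM.
  + by move=> t; rewrite in_itv/= => /andP[t0 _]; rewrite lee_fin exprn_ge0.
  + by apply/measurable_EFinP; exact: exprn_measurable.
- move=> m; apply/measurable_EFinP; apply: measurable_funM => //.
- move=> m t; rewrite in_itv/= => /andP[t0 _].
  by rewrite lee_fin mulr_ge0// exprn_ge0.
Qed.

(** With [B = - ln (1 - x)], the derivative of [B^(j+1)/(j+1)!] is [B^j/j!] divided by [1 - x], so
    [series_integral_div_1B] carries each power to the next. *)
Lemma cvg_Nln1B_series (R : realType) (k : nat) (x : R) : 0 <= x < 1 ->
  series (fun m => mzv_trunc (nseq k 1%N) m / m%:R * x ^+ m) @ \oo -->
  (- ln (1 - x)) ^+ k.+1 / (k.+1)`!%:R.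
Proof.
have dL j (t : R) : 0 <= t < 1 ->
    is_derive t 1 (fun y => (- ln (1 - y)) ^+ j.+1 / (j.+1)`!%:R)
      ((- ln (1 - t)) ^+ j / j`!%:R / (1 - t)).
  move=> /andP[_ t1].
  have := is_deriveMr _ _ _ _ ((j.+1)`!%:R^-1)
    (is_derive_exprn _ _ _ _ j.+1 (is_derive_Nln1B _ _ t1)).
  move=> h; apply: is_derive_eq => /=.
  have f0 : (j`!%:R : R) != 0 by rewrite pnatr_eq0 -lt0n fact_gt0.
  have t1' : 1 - t != 0 by rewrite subr_eq0 gt_eqF.
  have j0 : (1 + j%:R : R) != 0 by rewrite nat1r pnatr_eq0.
  rewrite factS natrM; field.
  by rewrite f0 t1' j0.
have L0 j : (- ln (1 - 0)) ^+ j.+1 / (j.+1)`!%:R = 0 :> R.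
  by rewrite subr0 ln1 oppr0 expr0n mul0r.
elim: k x => [|k IH] x x01.
  (* The induction starts from the constant power series 1. Its partial sums of coefficients are 1
     except at [m = 0], where division by 0 hides the mismatch. *)
  have -> : (fun m => mzv_trunc (nseq 0 1%N) m / m%:R * x ^+ m) =
    (fun m => series (fun m => (m == 0%N)%:R) m / m%:R * x ^+ m) :> (nat -> R).
    apply/funext => -[|m]; first by rewrite mulr0n invr0 !mulr0 !mul0r.
    by rewrite /= /series /= big_nat_recl//= big1 ?addr0//.
  apply: (@series_integral_div_1B R (fun m => (m == 0%N)%:R)
    (fun y => (- ln (1 - y)) ^+ 0 / 0`!%:R) _ x _ x01 _ _ (dL 0%N) (L0 0%N)) => //.
  move=> t t01; rewrite expr0 fact0 divr1.
  rewrite -cvg_shiftS /=.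
  have -> : (fun N => series (fun m => (m == 0%N)%:R * t ^+ m) N.+1) = cst 1 :> (nat -> R).
    apply/funext => N; rewrite /series /= big_nat_recl//= big1 ?addr0 ?mulr1//.
    by move=> i _; rewrite mul0r.
  exact: cvg_cst.
  move=> t _; have -> : (fun y : R => (- ln (1 - y)) ^+ 0 / 0`!%:R) = cst 1.
    by apply/funext => y; rewrite expr0 fact0 divr1.
  exact: derivable_cst.
have -> : (fun m => mzv_trunc (nseq k.+1 1%N) m / m%:R * x ^+ m) =
  (fun m => series (fun m => mzv_trunc (nseq k 1%N) m / m%:R) m / m%:R * x ^+ m) :> (nat -> R).
  apply/funext => m; congr (_ / _ * _).
  rewrite [nseq k.+1 _]/= mzv_trunc_series//; congr (series _ m).
  by apply/funext => i; rewrite expr1 mulrC.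
apply: (series_integral_div_1B _ _ (fun y => (- ln (1 - y)) ^+ k.+1 / (k.+1)`!%:R)) => //.
- by move=> m; rewrite divr_ge0// mzv_trunc_ge0.
- move=> t t01; apply: ex_derive; exact: dL.
Qed.

(** * Integrals of x^m (-ln x)^p over the unit interval *)

(** The bound [e^i >= i^(p+1)/(p+1)!] gives [e^(-i) i^p <= (p+1)!/i]. This handles boundary terms at
    [x = e^(-i)]. *)
Lemma cvg_expRN_exprn (R : realType) (m p : nat) :
  expR (- i%:R) ^+ m.+1 * i%:R ^+ p @[i --> \oo] --> (0 : R).
Proof.
rewrite -(cvg_shiftS (fun i => expR (- i%:R) ^+ m.+1 * i%:R ^+ p)) /=.
have h : (p.+1)`!%:R * harmonic i @[i --> \oo] --> (0 : R).
  rewrite -[X in _ --> X](mulr0 ((p.+1)`!%:R)).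
  by apply: cvgMl_tmp; exact: cvg_harmonic.
apply: (squeeze_cvgr _ (cvg_cst 0) h).
near=> i; apply/andP; split.
  by rewrite mulr_ge0// exprn_ge0// expR_ge0.
have i0 : 0 < i.+1%:R :> R by rewrite ltr0n.
have e1 : expR (- i.+1%:R) <= 1 :> R by rewrite -expR0 ler_expR oppr_le0 ltW.
apply: (@le_trans _ _ (expR (- i.+1%:R) * i.+1%:R ^+ p)).
  rewrite ler_wpM2r ?exprn_ge0//.
  by rewrite exprS ler_piMr ?expR_ge0// exprn_ile1// expR_ge0.
rewrite expRN /harmonic /= ler_pdivlMr// -mulrA -exprSr.
rewrite ler_pdivrMl ?expR_gt0//.
rewrite -ler_pdivrMr ?ltr0n ?fact_gt0//.
by apply: le_trans (expR_ge1Dxn p (ltW i0)); rewrite lerDr.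
Unshelve. all: by end_near.
Qed.

(** Integration by parts yields the primitives recursively in [p]. The limit at 0 is taken along
    [e^(-i)], where [- ln x] is just [i]. *)
Lemma primitive_exprn_Nln (R : realType) (m p : nat) : exists G : R -> R,
  [/\ forall x : R, 0 < x -> is_derive x 1 G (x ^+ m * (- ln x) ^+ p),
      G 1 = p`!%:R / m.+1%:R ^+ p.+1
    & G (expR (- i%:R)) @[i --> \oo] --> 0].
Proof.
have m0 : (m.+1%:R : R) != 0 by rewrite pnatr_eq0.
have dP (x : R) : is_derive x 1 (fun y => y ^+ m.+1 / m.+1%:R : R) (x ^+ m).
  have := is_deriveMr _ _ _ _ (m.+1%:R^-1) (is_derive_exprn _ _ _ _ m.+1 (is_derive_id x 1)).
  move=> h; apply: is_derive_eq => /=.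
  by rewrite mulr1 mulrAC mulfV ?mul1r.
have cP q : expR (- i%:R) ^+ m.+1 / m.+1%:R * (- ln (expR (- i%:R))) ^+ q @[i --> \oo] --> (0 : R).
  have -> : (fun i : nat => expR (- i%:R) ^+ m.+1 / m.+1%:R * (- ln (expR (- i%:R))) ^+ q : R) =
      (fun i : nat => m.+1%:R^-1 * (expR (- i%:R) ^+ m.+1 * i%:R ^+ q)).
    by apply/funext => i; rewrite expRK opprK mulrAC mulrC.
  by rewrite -[X in _ --> X](mulr0 (m.+1%:R^-1)); apply: cvgMl_tmp; exact: cvg_expRN_exprn.
elim: p => [|p [G [dG G1 Glim]]].
  exists (fun x => x ^+ m.+1 / m.+1%:R); split.
  - by move=> x _; rewrite expr0 mulr1.
  - by rewrite expr1n fact0.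
  - by have := cP 0%N; under eq_fun do rewrite expr0 mulr1.
exists (fun x => x ^+ m.+1 / m.+1%:R * (- ln x) ^+ p.+1 + G x * (p.+1%:R / m.+1%:R)); split.
- move=> x x0.
  have d1 := is_deriveM (dP x) (is_derive_exprn _ _ _ _ p.+1 (is_derive_Nln _ _ x0)).
  have d2 := is_deriveMr _ _ _ _ (p.+1%:R / m.+1%:R) (dG x x0).
  have h := is_deriveD d1 d2.
  apply: is_derive_eq; rewrite /= /GRing.scale /=.
  have xn0 : x != 0 by rewrite gt_eqF.
  rewrite !exprS; field.
  by rewrite nat1r m0 xn0.
- rewrite ln1 oppr0 expr0n /= mulr0 add0r G1 factS natrM [in RHS]exprS invfM.
  by ring.
- rewrite -[X in _ --> X]addr0; apply: cvgD; first exact: cP.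
  by rewrite -(mul0r (p.+1%:R / m.+1%:R)); exact: cvgMr_tmp.
Qed.

Lemma integral_exprn_Nln (R : realType) (m p : nat) :
  (\int[@lebesgue_measure R]_(x in `]0%R, 1%R[) (x ^+ m * (- ln x) ^+ p)%:E =
   (p`!%:R / m.+1%:R ^+ p.+1)%:E)%E.
Proof.
have [G [dG G1 Glim]] := primitive_exprn_Nln R m p.
have mf (D : set R) : measurable_fun D (fun x : R => (x ^+ m * (- ln x) ^+ p)%:E).
  apply/measurable_EFinP; apply: measurable_funM => //.
  apply: measurable_funX; apply: measurableT_comp => //.
  exact: measurable_funTS.
rewrite integral_itv_bndo_bndc//.
(* The singular endpoint 0 is approached by increasing intervals; the index [i.+1] keeps each of
   them nondegenerate. *)
pose F (i : nat) : set R := `[expR (- i.+1%:R), 1%R]%classic.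
have FE : \bigcup_i F i = `]0%R, 1%R]%classic.
  apply/seteqP; split=> x; rewrite /F /= in_itv/=.
    (* Conversely, [x] lies in [F i] as soon as [- ln x <= i + 1], hence the truncation of [- ln x]
       as witness below. *)
    move=> [i _] /=; rewrite in_itv/= => /andP[ex ->].
    by rewrite (lt_le_trans _ ex)// expR_gt0.
  move=> /andP[x0 x1]; exists (Num.truncn (- ln x)) => //=.
  rewrite in_itv/= x1 andbT -[leRHS]lnK ?posrE// ler_expR lerNl ltW//.
  exact: truncnS_gt.
pose f (x : R) := (x ^+ m * (- ln x) ^+ p)%:E.
have cF : (\int[@lebesgue_measure R]_(x in F i) f x)%E @[i --> \oo] -->
    (\int[@lebesgue_measure R]_(x in \bigcup_i F i) f x)%E.
  apply: ge0_nondecreasing_set_cvg_integral.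
  - move=> i j ij; apply/subsetPset => x; rewrite /F /= !in_itv/= => /andP[ex ->].
    by rewrite (le_trans _ ex)// ler_expR lerN2 ler_nat.
  - by move=> i; exact: measurable_itv.
  - by move=> i; exact: mf.
  - move=> i x; rewrite /F/= in_itv/= => /andP[ex x1]; rewrite lee_fin mulr_ge0//.
      by rewrite exprn_ge0// (le_trans _ ex)// expR_ge0.
    by rewrite exprn_ge0// oppr_ge0 ln_le0.
rewrite -FE -(cvg_lim (@ereal_hausdorff R) cF).
have E i : (\int[@lebesgue_measure R]_(x in F i) (x ^+ m * (- ln x) ^+ p)%:E =
    (G 1 - G (expR (- i.+1%:R)))%:E)%E.
  apply: is_derive_FTC2.
  - by rewrite -expR0 ltr_expR oppr_lt0.
  - by move=> x /andP[ex _]; apply: dG; rewrite (lt_le_trans _ ex)// expR_gt0.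
  - move=> x /andP[ex _]; apply: derivableM; first exact: exprn_derivable.
    have x0 : 0 < x by rewrite (lt_le_trans _ ex)// expR_gt0.
    apply: ex_derive; apply: is_derive_exprn; exact: is_derive_Nln.
under eq_fun do rewrite /f E.
apply: (cvg_lim (@ereal_hausdorff R)).
apply: cvg_EFin; first by apply: nearW.
rewrite -G1 -[X in _ --> X]subr0; apply: cvgB; first exact: cvg_cst.
by rewrite (cvg_shiftS (fun i => G (expR (- i%:R)))).
Qed.

(** * From integrals to multiple zeta values *)

Lemma integral_Nln_mzv (R : realType) (p k : nat) :
  (\int[@lebesgue_measure R]_(x in `]0%R, 1%R[)
     ((- ln x) ^+ p / p`!%:R * ((- ln (1 - x)) ^+ k.+1 / (k.+1)`!%:R) / x)%:E =
   (mzv (p.+2 :: nseq k 1%N) : R)%:E)%E.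
Proof.
pose c m : R := mzv_trunc (nseq k 1%N) m / m%:R.
have c0 m : 0 <= c m by rewrite divr_ge0// mzv_trunc_ge0.
have d0 m : 0 <= c m / p`!%:R by apply: divr_ge0; rewrite ?ler0n.
have e0 m (x : R) : 0 < x < 1 -> 0 <= x ^+ m * (- ln x) ^+ p.
  move=> /andP[x0 x1]; apply: mulr_ge0; apply: exprn_ge0; first exact: ltW.
  by rewrite oppr_ge0 ln_le0// ltW.
have mf (D : set R) m : measurable_fun D (fun x : R => x ^+ m * (- ln x) ^+ p).
  apply: measurable_funM => //.
  apply: measurable_funX; apply: measurableT_comp => //.
  exact: measurable_funTS.
(* The factor [1/x] lowers the exponent to [m.-1]; at [m = 0] this is harmless because [c 0 = 0]. *)
have -> : (\int[@lebesgue_measure R]_(x in `]0%R, 1%R[)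
     ((- ln x) ^+ p / p`!%:R * ((- ln (1 - x)) ^+ k.+1 / (k.+1)`!%:R) / x)%:E =
   \int[@lebesgue_measure R]_(x in `]0%R, 1%R[)
     \sum_(m <oo) (c m / p`!%:R * (x ^+ m.-1 * (- ln x) ^+ p))%:E)%E.
  apply: eq_integral => x; rewrite inE /= in_itv/= => /andP[x0 x1].
  apply/esym/nneseries_EFin_eq.
    by move=> m; apply: mulr_ge0 => //; apply: e0; rewrite x0.
  have x01 : 0 <= x < 1 by rewrite ltW.
  have h := @cvgMl_tmp _ _ _ _ _ ((- ln x) ^+ p / p`!%:R / x) _ (cvg_Nln1B_series R k x x01).
  have <- : (- ln x) ^+ p / p`!%:R / x * ((- ln (1 - x)) ^+ k.+1 / (k.+1)`!%:R) =
      (- ln x) ^+ p / p`!%:R * ((- ln (1 - x)) ^+ k.+1 / (k.+1)`!%:R) / x by rewrite mulrAC.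
  have E : (fun N => (- ln x) ^+ p / p`!%:R / x * series (fun m => c m * x ^+ m) N) =
    series (fun m => c m / p`!%:R * (x ^+ m.-1 * (- ln x) ^+ p)).
    apply/funext => N; rewrite /series /= big_distrr /=.
    apply: eq_bigr => -[|m] _; first by rewrite /c mulr0n invr0 !(mulr0, mul0r).
    rewrite /= exprS; field.
    by rewrite pnatr_eq0 -lt0n fact_gt0 gt_eqF.
  by rewrite -E; exact: h.
rewrite integral_nneseries//=; last 2 first.
- by move=> m; apply/measurable_EFinP; apply: measurable_funM => //; exact: mf.
- by move=> m x; rewrite in_itv/= lee_fin => x01; apply: mulr_ge0 => //; exact: e0.
rewrite -mzv_eseries//.
apply: eq_eseriesr => m _.
under eq_integral do rewrite EFinM.
rewrite ge0_integralZl_EFin//=.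
- rewrite integral_exprn_Nln -EFinM; congr (_%:E).
  rewrite /c; case: m => [|m].
    by rewrite mulr0n invr0 !(mulr0, mul0r) expr0n invr0 mul0r.
  rewrite [in RHS]exprS invfM.
  have f0 : (p`!%:R : R) != 0 by rewrite pnatr_eq0 -lt0n fact_gt0.
  have -> (u v w z : R) : u * v / w * (w * z) = u * v * z * (w / w) by ring.
  by rewrite divff// mulr1 -mulrA mulrC.
- by move=> x; rewrite in_itv/= lee_fin; exact: e0.
- by apply/measurable_EFinP; exact: mf.
Qed.

(** * Inner integral over a slice of the triangle *)

Lemma integral_triangle_slice (R : realType) (n : nat) (x : R) : 0 < x < 1 ->
  (\int[@lebesgue_measure R]_(y in `[(1 - x)%R, 1%R])
     ((- ln (x * y)) ^+ n / (x * y))%:E =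
   (n`!%:R * \sum_(0 <= k < n.+1) ((- ln x) ^+ (n - k) / (n - k)`!%:R *
      ((- ln (1 - x)) ^+ k.+1 / (k.+1)`!%:R) / x))%:E)%E.
Proof.
move=> /andP[x0 x1].
have x1' : 0 < 1 - x by rewrite subr_gt0.
pose A := - ln x.
have xn0 : x != 0 by rewrite gt_eqF.
have -> : (\int[@lebesgue_measure R]_(y in `[(1 - x)%R, 1%R])
     ((- ln (x * y)) ^+ n / (x * y))%:E =
   \int[@lebesgue_measure R]_(y in `[(1 - x)%R, 1%R])
     ((A - ln y) ^+ n / (x * y))%:E)%E.
  apply: eq_integral => y; rewrite inE /= in_itv/= => /andP[xy y1].
  by rewrite lnM ?posrE ?opprD// (lt_le_trans x1').
have dA (y : R) : 0 < y -> is_derive y 1 (fun y => A - ln y) (- y^-1).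
  move=> y0; have h := is_deriveD (is_derive_cst A y 1) (is_derive_Nln _ _ y0).
  by apply: is_derive_eq; rewrite add0r.
have dF (y : R) : 1 - x <= y <= 1 ->
    is_derive y 1 (fun y => (A - ln y) ^+ n.+1 * (- (n.+1%:R * x)^-1)) ((A - ln y) ^+ n / (x * y)).
  move=> /andP[xy _]; have y0 : 0 < y by exact: lt_le_trans xy.
  have h := is_deriveMr _ _ _ _ (- (n.+1%:R * x)^-1) (is_derive_exprn _ _ _ _ n.+1 (dA y y0)).
  apply: is_derive_eq => /=; field.
  by rewrite nat1r pnatr_eq0 xn0 gt_eqF.
have x1lt : 1 - x < 1 by rewrite ltrBlDr ltrDl.
have -> := is_derive_FTC2 _ (fun y => (A - ln y) ^+ n / (x * y)) _ _ _ x1lt dF.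
  congr (_%:E).
  rewrite ln1 subr0; set B := - ln (1 - x).
  (* The leading binomial term [A^(n+1)] cancels the value of the primitive at [y = 1]; the
     remaining index [i.+1] becomes the exponent [k.+1]. *)
  rewrite exprDn big_ord_recl /= subn0 mulr1 bin0 mulr1n.
  rewrite mulrDl opprD addrA.
  rewrite subrr sub0r mulrN opprK big_mkord big_distrl big_distrr /=.
  apply: eq_bigr => i _; rewrite /bump leq0n add1n subSS -mulr_natr.
  (* Writing the binomial coefficient through factorials releases a factor [n.+1], which cancels the
     one in the primitive. *)
  have : ('C(n.+1, i.+1) * (i.+1`! * (n - i)`!))%N%:R = (n.+1 * n`!)%N%:R :> R.
    by rewrite -factS -(@bin_fact n.+1 i.+1) ?subSS// ltnS -ltnS.
  have f1 : (i.+1`!%:R : R) != 0 by rewrite pnatr_eq0 -lt0n fact_gt0.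
  have f2 : ((n - i)`!%:R : R) != 0 by rewrite pnatr_eq0 -lt0n fact_gt0.
  have n0 : (n.+1%:R : R) != 0 by rewrite pnatr_eq0.
  rewrite -/A; move: f1 f2 n0.
  move: (i.+1`!) ((n - i)`!) (n`!) ('C(_, _)) => u v z c u0 v0 w0.
  rewrite !natrM; move: (n.+1%:R : R) w0 => w w0 E.
  have -> : c%:R = w * z%:R / (u%:R * v%:R) :> R by rewrite -E mulfK// mulf_neq0.
  field.
  by rewrite xn0 u0 v0 w0.
move=> y /andP[xy _]; have y0 : 0 < y by exact: lt_le_trans xy.
apply: derivableM.
  apply: ex_derive; apply: is_derive_exprn; exact: dA.
apply: derivableV; first by rewrite mulf_neq0// gt_eqF.
by apply: derivableM.
Qed.

(** * Measurability and assembly by Tonelli *)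

Lemma measurable_triangleT (R : realType) : measurable (@triangleT R).
Proof.
have -> : @triangleT R = `[0, 1] `*` `[0, 1] `&`
    (fun p : R * R => p.1 + p.2) @^-1` `[1, +oo[.
  apply/seteqP; split=> -[x y]; rewrite /triangleT /= !in_itv /= ?andbT.
    by move=> [? [? ?]].
  by move=> [[? ?] ?].
apply: measurableI; first by apply: measurableX; exact: measurable_itv.
rewrite -[X in measurable X]setTI.
have : measurable_fun setT (fun p : R * R => p.1 + p.2).
  by apply: measurable_funD; [exact: measurable_fst|exact: measurable_snd].
by apply => //; exact: measurable_itv.
Qed.

(** Inversion is continuous away from 0, and the singleton [{0}] is treated apart. *)
Lemma measurable_funV (R : realType) : measurable_fun setT (fun x : R => x^-1).
Proof.
have o0 : open [set x : R | x != 0] by exact: open_neq.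
rewrite -(setvU [set x : R | x != 0]); apply/measurable_funU.
- by apply: measurableC; exact: open_measurable.
- exact: open_measurable.
split; last first.
  by apply: open_continuous_measurable_fun => // x; rewrite inE /= => x0; exact: inv_continuous.
have -> : ~` [set x : R | x != 0] = [set 0].
  by apply/seteqP; split=> x /=; [move/negP; rewrite negbK => /eqP|move=> ->; rewrite eqxx].
exact: measurable_fun_set1.
Qed.

Lemma measurable_integrand (R : realType) (n : nat) :
  measurable_fun setT (fun p : R * R => ((- ln (p.1 * p.2)) ^+ n / (p.1 * p.2))).
Proof.
have mm : measurable_fun setT (fun p : R * R => p.1 * p.2).
  by apply: measurable_funM; [exact: measurable_fst|exact: measurable_snd].
apply: measurable_funM.
  apply: measurable_funX; apply: measurableT_comp => //.
  by apply: measurableT_comp mm; exact: measurable_ln.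
by apply: measurableT_comp mm; exact: measurable_funV.
Qed.

Theorem theorem1 (R : realType) (n : nat) :
  (\int[(@lebesgue_measure R) \x (@lebesgue_measure R)]_(p in triangleT)
      (((- ln (p.1 * p.2)) ^+ n / (p.1 * p.2))%:E))%E
  = ((n`!)%:R * \sum_(0 <= k < n.+1) mzv ((n - k + 2)%N :: nseq k 1%N))%:E.
Proof.
pose f (p : R * R) := ((- ln (p.1 * p.2)) ^+ n / (p.1 * p.2))%:E.
have mf : measurable_fun setT (f \_ triangleT).
  apply/(measurable_restrictT _ (measurable_triangleT R)).
  by apply: measurable_funTS; apply/measurable_EFinP; exact: measurable_integrand.
(* The values of [ln] and of the inverse at 0 keep the integrand nonnegative even at the two
   vertices where [xy = 0]. *)
have f0 p : (0 <= (f \_ triangleT) p)%E.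
  apply: erestrict_ge0 => -[x y] [/= /andP[x0 x1] [/andP[y0 y1] _]].
  rewrite lee_fin divr_ge0 ?mulr_ge0// exprn_ge0// oppr_ge0 ln_le0//.
  by rewrite mulr_ile1.
pose F (x : R) := (\int[@lebesgue_measure R]_y (f \_ triangleT) (x, y))%E.
have mF : measurable_fun setT F.
  have := @measurable_fun_fubini_tonelli_F _ _ _ _ R (@lebesgue_measure R) (f \_ triangleT) mf f0.
  exact.
rewrite integral_mkcond -/f fubini_tonelli1//.
rewrite -[LHS]/(\int[@lebesgue_measure R]_x F x)%E.
(* Slices over [x] outside [[0, 1]] are empty. Dropping the null endpoints afterwards makes both [x]
   and [1 - x] positive. *)
have -> : F = F \_ `[0%R, 1%R].
  apply/funext => x; rewrite patchE; case: ifPn => // x01.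
  apply: integral0_eq => y _; rewrite patchE; case: ifPn => // /set_mem[/= h _].
  by case/negP: x01; apply/mem_set; rewrite /= in_itv.
rewrite -integral_mkcond integral_itv_bndoo; last exact: measurable_funTS.
pose g (k : nat) (x : R) := ((- ln x) ^+ (n - k) / (n - k)`!%:R *
      ((- ln (1 - x)) ^+ k.+1 / (k.+1)`!%:R) / x)%:E.
have g0 k (x : R) : `]0%R, 1%R[%classic x -> (0 <= g k x)%E.
  rewrite /= in_itv/= => /andP[x0 x1]; rewrite lee_fin.
  have h (y : R) (j : nat) : 0 < y < 1 -> 0 <= (- ln y) ^+ j / j`!%:R.
    move=> /andP[y0 y1]; apply: divr_ge0; last exact: ler0n.
    by apply: exprn_ge0; rewrite oppr_ge0 ln_le0// ltW.
  apply: divr_ge0; last exact: ltW.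
  by apply: mulr_ge0; apply: h; rewrite ?x0// subr_gt0 x1 ltrBlDr ltrDl.
have mg k (D : set R) : measurable_fun D (g k).
  apply: measurable_funTS; apply/measurable_EFinP.
  have mln : measurable_fun setT (fun x : R => - ln x) by exact: measurableT_comp.
  apply: measurable_funM; last exact: measurable_funV.
  apply: measurable_funM; apply: measurable_funM => //; apply: measurable_funX => //.
  by apply: measurableT_comp mln _; exact: measurable_funB.
have -> : (\int[@lebesgue_measure R]_(x in `]0%R, 1%R[) F x =
    \int[@lebesgue_measure R]_(x in `]0%R, 1%R[)
      (n`!%:R%:E * \sum_(0 <= k < n.+1) g k x))%E.
  apply: eq_integral => x; rewrite inE /= in_itv/= => /andP[x0 x1].
  rewrite /g sumEFin -EFinM -integral_triangle_slice ?x0// [RHS]integral_mkcond.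
  apply: eq_integral => y _; rewrite !patchE; congr (if _ then _ else _).
  (* The slice of the triangle over [x] is exactly [[1 - x, 1]]; in the converse direction [0 <= y]
     comes from [x <= 1 <= x + y]. *)
  apply/idP/idP => /set_mem h; apply/mem_set; move: h; rewrite /triangleT /= in_itv/=.
    by move=> [_ [/andP[_ ->] h]]; rewrite lerBlDl h.
  rewrite lerBlDl => /andP[h ->]; rewrite (ltW x0) (ltW x1) h; split=> //; split=> //.
  by rewrite andbT -(lerD2l x) (le_trans _ h)// addr0 ltW.
rewrite ge0_integralZl_EFin//=; last 2 first.
- by move=> x x01; apply: sume_ge0 => k _; exact: g0.
- by apply: emeasurable_sum => k; exact: mg.
rewrite ge0_integral_sum//; last by move=> k; exact: mg.
have gE k : (\int[@lebesgue_measure R]_(x in `]0%R, 1%R[) g k x)%E =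
    (mzv ((n - k + 2)%N :: nseq k 1%N))%:E by rewrite /g integral_Nln_mzv addn2.
rewrite (eq_bigr _ (fun k _ => gE k)).
by rewrite sumEFin -EFinM.
Qed.
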